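(* Let $G,H$ be two groups of order $n$, let $k\ge 1$, $r\ge 0$, $J\in\{I,II\}$, and let $\overline{x}\in G^k$, $\overline{y}\in H^k$. Starting from the initial configuration in which, for each $i=1,\dots,k$, pebble $p_i$ is on $x_i$ and $p_i'$ is on $y_i$, Spoiler has a winning strategy in the $k$-pebble, $r$-round, 2-ary Version $J$ pebble game if and only if $\chi^{2,J}_r(\overline{x})\neq\chi^{2,J}_r(\overline{y})$.
   Context: Tuples: for $\overline{g}\in G^m,\overline{h}\in H^m$, $(\overline{g},\overline{h})$ gives a well-defined map if $g_i=g_j\Leftrightarrow h_i=h_j$ for all $i,j$; a partial isomorphism if moreover $g_ig_j=g_l\Leftrightarrow h_ih_j=h_l$ for all $i,j,l$; a marked isomorphism if it gives a well-defined map and $g_i\mapsto h_i$ extends to an isomorphism $\langle g_1,\dots,g_m\rangle\to\langle h_1,\dots,h_m\rangle$. The $k$-pebble, $r$-round, 2-ary Version $J$ game on $G,H$: Spoiler and Duplicator, $k$ pebble pairs $(p_i,p_i')$. Each round: (1) Spoiler picks up one or two pebble pairs; (2) the winning condition is checked; (3) Duplicator chooses a bijection $f\colon G\to H$; (4) Spoiler places each picked-up $p_i$ on some $v_i\in G$ and $p_i'$ goes on $f(v_i)$. Spoiler wins when, for the pebbled elements $\overline{v}$ of $G$ and corresponding $\overline{v}'$ of $H$, $(\overline{v},\overline{v}')$ is not a partial isomorphism (Version I) / not a marked isomorphism (Version II); the condition is checked on the initial configuration, at step (2) of each round, and on the configuration after round $r$; Spoiler wins the $r$-round game if it is violated at some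 such check. Coloring: for a $k$-tuple $\overline{x}$, distinct $i,j\in[k]$ and elements $y,z$, $\overline{x}_{(i,j)\leftarrow(y,z)}$ is the tuple agreeing with $\overline{x}$ except that entry $i$ is $y$ and entry $j$ is $z$; $\overline{x}_{i\leftarrow y}$ replaces entry $i$ by $y$. Initial coloring on $G^k\cup H^k$: Version I, $\chi^{2,I}_0(\overline{x})=\chi^{2,I}_0(\overline{y})$ iff $(\overline{x},\overline{y})$ is a partial isomorphism; Version II, $\chi^{2,II}_0(\overline{x})=\chi^{2,II}_0(\overline{y})$ iff $(\overline{x},\overline{y})$ is a marked isomorphism (same marked isomorphism type). Refinement: given a coloring $\chi$ of $G^k\cup H^k$, for $\overline{x}\in G^k$ (resp. $H^k$) and $i,j\in[k]$ define an edge-colored graph $\Gamma_{\overline{x},\chi,i,j}$: if $i=j$, vertex set $G$ (resp. $H$), all self-loops and no other edges, loop $(g,g)$ colored $\chi(\overline{x}_{i\leftarrow g})$; if $i\neq j$, the complete directed graph with self-loops on $G$ (resp. $H$), edge $(y,z)$ colored $\chi(\overline{x}_{(i,j)\leftarrow(y,z)})$. Writing $[\Gamma]$ for the color-isomorphism class (isomorphisms preserving edge colors), $R(\chi)(\overline{x})=(\chi(\overline{x});[\Gamma_{\overline{x},\chi,1,1}],[\Gamma_{\overline{x},\chi,1,2}],\dots,[\Gamma_{\overline{x},\chi,k,k}])$ (all pairs $i\le j$). Set $\chi^{2,J}_{r+1}=R(\chi^{2,J}_r)$.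
   Formalization: The winning condition is also checked on the full configuration after every intermediate round, not only after round r; without this the claim fails, e.g. for G=H=Z/4×Z/8, k=r=2, Version I, x=(a,a), y=(b,b) with a=(1,0), b=(0,1). *)

(* Defs.v *)
From HB Require Import structures.
From mathcomp Require Import all_boot all_fingroup.

Set Implicit Arguments.
Unset Strict Implicit.
Unset Printing Implicit Defensive.

Local Open Scope group_scope.

(* Tuples are families over an arbitrary finite index type, so that the same  *)
(* predicates apply to a k-tuple and to the subtuple of pebbles on the board. *)
Section TupleMaps.

Variables (gT hT : finGroupType) (I : finType) (g : I -> gT) (h : I -> hT).

Definition well_defined_map : Prop :=
  forall i j, g i = g j <-> h i = h j.

Definition partial_iso : Prop :=
  well_defined_map /\
  forall i j l, g i * g j = g l <-> h i * h j = h l.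

Definition marked_iso : Prop :=
  well_defined_map /\
  exists f : {morphism <<[set g i | i : I]>> >-> hT},
    isom <<[set g i | i : I]>> <<[set h i | i : I]>> f /\
    forall i, f (g i) = h i.

End TupleMaps.

Inductive version := VersionI | VersionII.

Definition version_iso (J : version) (gT hT : finGroupType) (I : finType)
    (g : I -> gT) (h : I -> hT) : Prop :=
  match J with
  | VersionI => partial_iso g h
  | VersionII => marked_iso g h
  end.

Section Game.

Variables (J : version) (gT hT : finGroupType) (k : nat).

Implicit Types (x : {ffun 'I_k -> gT}) (y : {ffun 'I_k -> hT}).

(* Between rounds every pebble pair is on the board, so a position is just a  *)
(* pair of k-tuples; S is the set of pebble pairs currently picked up.        *)
Definition violated_off x y (S : {set 'I_k}) : Prop :=
  ~ version_iso J (fun i : {i : 'I_k | i \notin S} => x (val i))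
                  (fun i : {i : 'I_k | i \notin S} => y (val i)).

Definition place (T : Type) (S : {set 'I_k}) (v : 'I_k -> T)
    (x : {ffun 'I_k -> T}) : {ffun 'I_k -> T} :=
  [ffun i => if i \in S then v i else x i].

(* After one round of the r.+1-round game the players face the r-round game   *)
(* from the new position; hence the full configuration is checked initially   *)
(* and after every round, besides the check following each pick-up.  Omitting *)
(* the checks on intermediate full configurations would break the equivalence *)
(* with colour refinement: take both groups to be Z/4 x Z/8, k = r = 2,       *)
(* Version I, x = (a, a) and y = (b, b) with a = (1, 0) and b = (0, 1).       *)
Fixpoint spoiler_wins (r : nat) x y : Prop :=
  ~ version_iso J x y \/
  match r with
  | 0 => False
  | r'.+1 =>
      exists S : {set 'I_k},
        (1 <= #|S| <= 2)%N /\
        (violated_off x y S \/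
         forall f : gT -> hT, bijective f ->
         exists v : 'I_k -> gT,
           spoiler_wins r' (place S v x) (place S (f \o v) y))
  end.

End Game.

(* None stands for the absence of an edge. *)
Record egraph (C : Type) := EGraph {
  vertex : finType;
  edge : vertex -> vertex -> option C }.

Arguments edge {C} e u v.

Definition egraph_iso (C : Type) (A B : egraph C) : Prop :=
  exists f : vertex A -> vertex B,
    bijective f /\ forall u v, edge A u v = edge B (f u) (f v).

Definition iso_class (C : Type) (A : egraph C) : egraph C -> Prop :=
  fun B => egraph_iso A B.

Section Coloring.

Variables (J : version) (gT hT : finGroupType) (k : nat).

(* The disjoint union of G^k and H^k is indexed by a boolean: false for G and *)
(* true for H.                                                                *)
Definition side (b : bool) : finGroupType := if b then hT else gT.

Definition coloring (C : Type) := forall b : bool, {ffun 'I_k -> side b} -> C.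

Definition subst1 b (x : {ffun 'I_k -> side b}) (i : 'I_k) (u : side b) :
    {ffun 'I_k -> side b} :=
  [ffun l => if l == i then u else x l].

Definition subst2 b (x : {ffun 'I_k -> side b}) (i j : 'I_k) (u v : side b) :
    {ffun 'I_k -> side b} :=
  [ffun l => if l == i then u else if l == j then v else x l].

Definition Gamma (C : Type) (chi : coloring C) b (x : {ffun 'I_k -> side b})
    (i j : 'I_k) : egraph C :=
  @EGraph C (side b) (fun u v =>
    if i == j then (if u == v then Some (chi b (subst1 x i u)) else None)
    else Some (chi b (subst2 x i j u v))).

Definition refined (C : Type) : Type :=
  (C * ({p : 'I_k * 'I_k | (p.1 <= p.2)%N} -> egraph C -> Prop))%type.

Definition refine (C : Type) (chi : coloring C) : coloring (refined C) :=
  fun b x =>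
    (chi b x, fun p => iso_class (Gamma chi x (val p).1 (val p).2)).

(* The initial colour of a tuple is its class for the partial (resp. marked)  *)
(* isomorphism relation on the disjoint union of G^k and H^k.                 *)
Definition color0 : Type := coloring Prop.

Definition chi0 : coloring color0 := fun b x => fun b' z => version_iso J x z.

Fixpoint color (r : nat) : Type :=
  if r is r'.+1 then refined (color r') else color0.

Fixpoint chi (r : nat) : coloring (color r) :=
  match r return coloring (color r) with
  | 0 => chi0
  | r'.+1 => refine (chi r')
  end.

End Coloring.

(* The colouring chi_r restricted to G^k and to H^k respectively. *)
Definition chiG (J : version) (gT hT : finGroupType) (k r : nat)
    (x : {ffun 'I_k -> gT}) : color gT hT k r :=
  @chi J gT hT k r false x.

Definition chiH (J : version) (gT hT : finGroupType) (k r : nat)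
    (y : {ffun 'I_k -> hT}) : color gT hT k r :=
  @chi J gT hT k r true y.

(* Main.v *)
Require Import Defs.
From mathcomp Require Import all_boot all_fingroup.
From mathcomp Require Import boolp.

(** Both sides are compared through the recursive description of Duplicator's
    winning positions.  Picking up a set [S] of one or two pebbles and answering
    with a bijection [f] is the same as giving an isomorphism of the graphs
    Gamma for the index pair underlying [S], so by induction Duplicator survives
    [r] rounds iff the colours after [r] refinements agree.  Two points need an
    argument: the check after a pick-up is redundant, since isomorphism passes
    to subtuples, and the colour component [chi_r x] of [chi_(r+1) x] is
    recovered from the game because Duplicator may stop one round early. *)

Set Implicit Arguments.
Unset Strict Implicit.
Unset Printing Implicit Defensive.

Local Open Scope group_scope.

(** * Isomorphism of tuples: equivalence laws and reindexing *)

Lemma partial_iso_refl (gT : finGroupType) (I : finType) (g : I -> gT) :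
  partial_iso g g.
Proof. by []. Qed.

Lemma partial_iso_sym (gT hT : finGroupType) (I : finType)
    (g : I -> gT) (h : I -> hT) : partial_iso g h -> partial_iso h g.
Proof.
by case=> wd pm; split=> [i j|i j l]; apply: iff_sym; [exact: wd|exact: pm].
Qed.

Lemma partial_iso_trans (gT hT kT : finGroupType) (I : finType)
    (g : I -> gT) (h : I -> hT) (l : I -> kT) :
  partial_iso g h -> partial_iso h l -> partial_iso g l.
Proof.
move=> [wd1 pm1] [wd2 pm2].
by split=> [i j|i j m]; [apply: iff_trans (wd2 i j)|apply: iff_trans (pm2 i j m)].
Qed.

(* The image of the generated group and well-definedness are automatic. *)
Lemma marked_isoP (gT hT : finGroupType) (I : finType)
    (g : I -> gT) (h : I -> hT) :
  marked_iso g h <->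
  exists f : gT -> hT,
    [/\ {in <<[set g i | i : I]>> &, {morph f : a b / a * b}},
        {in <<[set g i | i : I]>> &, injective f} & forall i, f (g i) = h i].
Proof.
split=> [[_ [f [isof fg]]]|[f [fM f_inj fg]]].
  exists f; split=> //; first exact: morphM.
  exact/injmP/(isom_inj isof).
have mem_g i : g i \in <<[set g i | i : I]>>.
  by apply/mem_gen/imsetP; exists i.
split=> [i j|].
  by rewrite -!fg; split=> [->//|/f_inj]; apply.
exists (Morphism fM); split=> //; apply/isomP; split; first exact/injmP.
rewrite morphim_gen ?subset_gen // morphimEsub ?subset_gen //= -imset_comp.
by congr <<_>>; apply: eq_imset => i /=.
Qed.

Lemma marked_iso_refl (gT : finGroupType) (I : finType) (g : I -> gT) :
  marked_iso g g.
Proof. by apply/marked_isoP; exists id; split. Qed.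

Lemma marked_iso_sym (gT hT : finGroupType) (I : finType)
    (g : I -> gT) (h : I -> hT) : marked_iso g h -> marked_iso h g.
Proof.
move=> [wd [f [isof fg]]]; split=> [i j|]; first exact: iff_sym.
have [injf imf] := isomP isof.
exists (isom_inv isof); split; first exact: isom_sym.
by move=> i; rewrite -fg; apply/invmE/mem_gen/imsetP; exists i.
Qed.

Lemma marked_iso_trans (gT hT kT : finGroupType) (I : finType)
    (g : I -> gT) (h : I -> hT) (l : I -> kT) :
  marked_iso g h -> marked_iso h l -> marked_iso g l.
Proof.
move=> [_ [f [isof fg]]] /marked_isoP[f' [f'M f'_inj f'h]].
have [/injmP f_inj imf] := isomP isof.
(* [f'] is multiplicative and injective only on the group generated by [h], so values of [f] must be
   placed there before composing. *)
have memf a : a \in <<[set g i | i : I]>> -> f a \in <<[set h i | i : I]>>.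
  by move=> ga; rewrite -imf mem_morphim.
apply/marked_isoP; exists (f' \o f); split=> [a b ga gb|a b ga gb|i] /=.
- by rewrite morphM // f'M // memf.
- by move=> /(f'_inj _ _ (memf a ga) (memf b gb)) /f_inj; apply.
- by rewrite fg.
Qed.

Lemma version_iso_refl J (gT : finGroupType) (I : finType) (g : I -> gT) :
  version_iso J g g.
Proof. by case: J; [exact: partial_iso_refl|exact: marked_iso_refl]. Qed.

Lemma version_iso_sym J (gT hT : finGroupType) (I : finType)
    (g : I -> gT) (h : I -> hT) : version_iso J g h -> version_iso J h g.
Proof. by case: J; [exact: partial_iso_sym|exact: marked_iso_sym]. Qed.

Lemma version_iso_trans J (gT hT kT : finGroupType) (I : finType)
    (g : I -> gT) (h : I -> hT) (l : I -> kT) :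
  version_iso J g h -> version_iso J h l -> version_iso J g l.
Proof. by case: J; [exact: partial_iso_trans|exact: marked_iso_trans]. Qed.

(** Reindexing can only shrink the generated subgroup, so the same map still serves. With [s := val]
    this passes to the pebbles left on the board. *)
Lemma version_iso_comp J (gT hT : finGroupType) (I I' : finType) (s : I' -> I)
    (g : I -> gT) (h : I -> hT) :
  version_iso J g h -> version_iso J (fun i => g (s i)) (fun i => h (s i)).
Proof.
case: J => /= [[wd pm]|/marked_isoP[f [fM f_inj fg]]].
  by split=> [i j|i j l]; [exact: wd|exact: pm].
have sub : {subset <<[set g (s i) | i : I']>> <= <<[set g i | i : I]>>}.
  apply/subsetP/genS/subsetP => _ /imsetP[i _ ->].
  by apply/imsetP; exists (s i).
apply/marked_isoP; exists f; split=> [||i]; last exact: fg.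
- exact: sub_in2 fM.
- exact: sub_in2 f_inj.
Qed.

(** * Isomorphism classes of edge-coloured graphs *)

Lemma egraph_iso_refl C (A : egraph C) : egraph_iso A A.
Proof. by exists id; split=> //; exists id. Qed.

Lemma egraph_iso_sym C (A B : egraph C) : egraph_iso A B -> egraph_iso B A.
Proof.
move=> [f [[f' fK f'K] fE]]; exists f'; split; first by exists f.
by move=> u v; rewrite fE !f'K.
Qed.

Lemma egraph_iso_trans C (A B D : egraph C) :
  egraph_iso A B -> egraph_iso B D -> egraph_iso A D.
Proof.
move=> [f [f_bij fE]] [f' [f'_bij f'E]]; exists (f' \o f).
by split=> [|u v]; [exact: bij_comp|rewrite fE f'E].
Qed.

Lemma iso_class_eq C (A B : egraph C) :
  iso_class A = iso_class B <-> egraph_iso A B.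
Proof.
split=> [eqAB|isoAB].
  by rewrite -/(iso_class A B) eqAB; exact: egraph_iso_refl.
apply/funext => D; apply/propext; split; apply: egraph_iso_trans => //.
exact: egraph_iso_sym.
Qed.

(** * Equality of colours and winning positions *)

Section GameColoring.

Variables (J : version) (gT hT : finGroupType) (k : nat).

Implicit Types (x : {ffun 'I_k -> gT}) (y : {ffun 'I_k -> hT}).

Lemma Gamma_diag_iso C (c : coloring gT hT k C) x y i :
  egraph_iso (@Gamma gT hT k C c false x i i) (@Gamma gT hT k C c true y i i) <->
  exists2 f : gT -> hT, bijective f &
    forall u, c false (@subst1 gT hT k false x i u) =
              c true (@subst1 gT hT k true y i (f u)).
Proof.
split=> [[f [f_bij fE]]|[f f_bij fE]]; exists f => //.
  by move=> u; move: (fE u u); rewrite /= !eqxx => -[].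
(* Injectivity of [f] sends non-loops to non-loops, where both edges are [None]. *)
split=> // u v /=; rewrite !eqxx (bij_eq f_bij).
by case: ifP => // _; rewrite fE.
Qed.

Lemma Gamma_offdiag_iso C (c : coloring gT hT k C) x y i j : i != j ->
  egraph_iso (@Gamma gT hT k C c false x i j) (@Gamma gT hT k C c true y i j) <->
  exists2 f : gT -> hT, bijective f &
    forall u v, c false (@subst2 gT hT k false x i j u v) =
                c true (@subst2 gT hT k true y i j (f u) (f v)).
Proof.
move=> /negbTE neq_ij; split=> [[f [f_bij fE]]|[f f_bij fE]]; exists f => //.
  by move=> u v; move: (fE u v); rewrite /= neq_ij => -[].
by split=> // u v /=; rewrite neq_ij fE.
Qed.

Lemma chi0_eq x y :
  @chi J gT hT k 0 false x = @chi J gT hT k 0 true y <-> version_iso J x y.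
Proof.
split=> [eq_xy|iso_xy].
  (* An initial colour is a predicate on tuples; both colours are evaluated at [y]. *)
  have : @chi J gT hT k 0 false x true y.
    by rewrite eq_xy; exact: version_iso_refl.
  by [].
apply: functional_extensionality_dep => b; apply/funext => z; apply/propext.
by split; apply: version_iso_trans => //; exact: version_iso_sym.
Qed.

Lemma chiS_eq r x y :
  @chi J gT hT k r.+1 false x = @chi J gT hT k r.+1 true y <->
  @chi J gT hT k r false x = @chi J gT hT k r true y /\
  forall i j : 'I_k, i <= j ->
    egraph_iso (@Gamma gT hT k _ (@chi J gT hT k r) false x i j)
               (@Gamma gT hT k _ (@chi J gT hT k r) true y i j).
Proof.
split=> [eq_xy|[eq_xy isoG]].
  split=> [|i j le_ij]; first exact: (congr1 fst eq_xy).
  have := congr1 (fun c => c.2 (exist _ (i, j) le_ij)) eq_xy.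
  by move/iso_class_eq.
congr pair; first exact: eq_xy.
by apply/funext => -[[i j] le_ij]; exact/iso_class_eq/isoG.
Qed.

(** Refinement retains the previous colour, so equality descends to the initial colouring. *)
Lemma chi_eq_version_iso r x y :
  @chi J gT hT k r false x = @chi J gT hT k r true y -> version_iso J x y.
Proof. by elim: r => [/chi0_eq|r IHr /chiS_eq[/IHr]]. Qed.

(** Dual of [spoiler_wins], without the check after a pick-up. *)
Fixpoint duplicator_wins (r : nat) x y : Prop :=
  version_iso J x y /\
  match r with
  | 0 => True
  | r'.+1 =>
      forall S : {set 'I_k}, (1 <= #|S| <= 2)%N ->
      exists2 f : gT -> hT, bijective f & forall v : 'I_k -> gT,
        duplicator_wins r' (place S v x) (place S (f \o v) y)
  end.

Lemma violated_off_full x y S : violated_off J x y S -> ~ version_iso J x y.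
Proof. by move=> viol xy; apply: viol; exact: (version_iso_comp val xy). Qed.

Lemma spoiler_winsP r x y : spoiler_wins J r x y <-> ~ duplicator_wins r x y.
Proof.
elim: r x y => [|r IHr] x y /=; first tauto.
split=> [[nxy [] //|[S [cardS [/violated_off_full nxy [] //|spoil]]]]|ndup].
  by move=> [_ /(_ S cardS)[f /spoil[v /IHr nv] /(_ v)]].
(* Classical direction: the negation is pushed in turn through the choices of [S], [f] and [v]. *)
have [xy|] := pselect (version_iso J x y); last by left.
right; apply: contrapT => nspoil; apply: ndup; split=> // S cardS.
apply: contrapT => nf; apply: nspoil; exists S; split=> //; right=> f f_bij.
apply: contrapT => nv; apply: nf; exists f => // v.
by apply: contrapT => /IHr spoil; apply: nv; exists v.
Qed.

Lemma duplicator_winsS r x y : duplicator_wins r.+1 x y -> duplicator_wins r x y.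
Proof.
elim: r x y => [|r IHr] x y; first by case.
move=> [xy dup]; split=> // S /dup[f f_bij fdup]; exists f => // v.
exact/IHr/fdup.
Qed.

Lemma place_set1 b (x : {ffun 'I_k -> side gT hT b}) (i : 'I_k) v :
  place [set i] v x = subst1 x i (v i).
Proof. by apply/ffunP=> l; rewrite !ffunE in_set1; case: eqP => // ->. Qed.

Lemma place_set2 b (x : {ffun 'I_k -> side gT hT b}) (i j : 'I_k) v :
  place [set i; j] v x = subst2 x i j (v i) (v j).
Proof.
apply/ffunP=> l; rewrite !ffunE in_set2.
by case: eqP => [->//|_] /=; case: eqP => // ->.
Qed.

(** The pair is ordered because [refined] records only index pairs with [i <= j]. *)
Lemma card12_cases (S : {set 'I_k}) : 1 <= #|S| <= 2 ->
  (exists i, S = [set i]) \/ (exists i j : 'I_k, i < j /\ S = [set i; j]).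
Proof.
case/andP; rewrite leq_eqVlt => /predU1P[card1 _|gt1 le2].
  by left; apply/cards1P; rewrite -card1.
have /cards2P[i [j [neq_ij ->]]] : #|S| == 2 by rewrite eqn_leq le2.
right; have [lt_ij|lt_ji|/val_inj eq_ij] := ltngtP i j; first by exists i, j.
  by exists j, i; rewrite setUC.
by rewrite eq_ij eqxx in neq_ij.
Qed.

Lemma duplicator_wins_chi r x y :
  duplicator_wins r x y <->
  @chi J gT hT k r false x = @chi J gT hT k r true y.
Proof.
elim: r x y => [|r IHr] x y.
  by split=> [[/chi0_eq]|/chi0_eq].
split=> [dup|eq_xy].
  apply/chiS_eq; split; first exact/IHr/duplicator_winsS.
  move: dup => [_ dup] i j; rewrite leq_eqVlt => /orP[/eqP/val_inj <-|lt_ij].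
    have [|f f_bij fdup] := dup [set i]; first by rewrite cards1.
    apply/Gamma_diag_iso; exists f => // u.
    have /IHr := fdup (fun=> u).
    by rewrite (@place_set1 false) (@place_set1 true).
  have neq_ij : i != j by rewrite -val_eqE neq_ltn lt_ij.
  have [|f f_bij fdup] := dup [set i; j]; first by rewrite cards2 neq_ij.
  apply/Gamma_offdiag_iso => //; exists f => // u v.
  (* Only the values at [i] and [j] matter, so [v] serves as the default elsewhere. *)
  have /IHr := fdup (fun l => if l == i then u else v).
  by rewrite (@place_set2 false) (@place_set2 true) /= eqxx eq_sym (negbTE neq_ij).
split; first exact: chi_eq_version_iso eq_xy.
move/chiS_eq: eq_xy => [_ isoG] S /card12_cases[[i ->]|[i [j [lt_ij ->]]]].
  have /Gamma_diag_iso[f f_bij fE] := isoG i i (leqnn i).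
  (* Duplicator plays the graph isomorphism: Spoiler's placement is a loop of Gamma, and [f]
     preserves its colour. *)
  exists f => // v; apply/IHr.
  by rewrite (@place_set1 false) (@place_set1 true) fE.
have neq_ij : i != j by rewrite -val_eqE neq_ltn lt_ij.
have /(Gamma_offdiag_iso _ _ _ neq_ij)[f f_bij fE] := isoG i j (ltnW lt_ij).
exists f => // v; apply/IHr.
by rewrite (@place_set2 false) (@place_set2 true) fE.
Qed.

End GameColoring.

Theorem theorem10 (gT hT : finGroupType) (n k r : nat) (J : version)
    (cardG : #|gT| = n) (cardH : #|hT| = n) (k_gt0 : (0 < k)%N)
    (x : {ffun 'I_k -> gT}) (y : {ffun 'I_k -> hT}) :
  spoiler_wins J r x y <-> @chiG J gT hT k r x <> @chiH J gT hT k r y.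
Proof.
apply: iff_trans (spoiler_winsP _ _ _ _) _.
by split=> nxy /duplicator_wins_chi.
Qed.
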